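(* Let $G$ be a finitely generated group with the unique root property. Then the natural homomorphism $\Lambda:\mathrm{Comm}(G)\to \mathrm{QI}(G)$ is an embedding (i.e. an injective homomorphism).
   Context: Unique root property: a group $G$ has the unique root property if for any $x,y\in G$ and any positive integer $n$, the equality $x^n=y^n$ implies $x=y$. Abstract commensurator group: let $\Omega(G)$ be the set of all isomorphisms between subgroups of finite index of $G$. Two such isomorphisms $\varphi_1:H_1\to H_1'$ and $\varphi_2:H_2\to H_2'$ are equivalent if there exists a subgroup $H$ of finite index in $G$ with $H\leqslant H_1\cap H_2$ and $\varphi_1|_H=\varphi_2|_H$. For $\alpha:G_1\to G_1'$ and $\beta:G_2\to G_2'$ in $\Omega(G)$, the product is $\alpha\beta:\alpha^{-1}(G_1'\cap G_2)\to\beta(G_1'\cap G_2)$ (first $\alpha$, then $\beta$). The quotient $\Omega(G)/{\sim}$ with $[\alpha][\beta]=[\alpha\beta]$ is the group $\mathrm{Comm}(G)$. Quasi-isometries: a map $f:X\to Y$ between metric spaces is a (coarse) quasi-isometry if there are constants $K,C,C_0>0$ such that $K^{-1}d_X(x_1,x_2)-C\leqslant d_Y(f(x_1),f(x_2))\leqslant K d_X(x_1,x_2)+C$ for all $x_1,x_2\in X$, and the $C_0$-neighborhood of $f(X)$ coincides with $Y$. Two quasi-isometries $f,g$ from $X$ to itself are equivalent if there is $M>0$ with $d(f(x),g(x))\leqslant M$ for all $x\in X$. $\mathrm{QI}(X)$ is the set of equivalence classes of quasi-isometries from $X$ to itself; it is a group under composition, where products are written in the same order as in $\mathrm{Comm}(G)$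 ($[f][g]$ is the class of ''first $f$, then $g$''). Word metric: for a group $G$ with finite generating set $S$, $|g|$ is the minimal $k$ such that $g=s_1s_2\cdots s_k$ with $s_i\in S\cup S^{-1}$, and $d(x,y)=|x^{-1}y|$. $\mathrm{QI}(G)$ is the quasi-isometry group of $G$ with this metric; it does not depend on the choice of $S$. The map $\Lambda$: let $\varphi:H\to H'$ be an isomorphism between two finite index subgroups of $G$. Choose a right transversal $T$ for $H$ in $G$ with $1\in T$ (so each element of $G$ is uniquely $ht$ with $h\in H$, $t\in T$), and define $f_\varphi:G\to G$ by $f_\varphi(ht)=\varphi(h)$ for $h\in H$, $t\in T$. Then $f_\varphi$ is a quasi-isometry and $\Lambda([\varphi]):=[f_\varphi]$; this is a well-defined homomorphism. *)

(* Defs.v *)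
From HB Require Import structures.
From mathcomp Require Import all_boot all_order all_algebra.
From mathcomp Require Import boolp classical_sets functions cardinality.
From mathcomp Require Import reals topology lra.

Set Implicit Arguments.
Unset Strict Implicit.
Unset Printing Implicit Defensive.

Import Order.TTheory GRing.Theory Num.Theory.

Local Open Scope classical_set_scope.
Local Open Scope group_scope.
Local Open Scope quotient_scope.

Definition unique_root (G : groupType) :=
  forall (x y : G) (n : nat), (0 < n)%N -> x ^+ n = y ^+ n -> x = y.

Section FiniteIndex.
Variable G : groupType.
Implicit Types (H K : set G) (x y g h : G).

Definition right_coset H g : set G := [set h * g | h in H].

Definition finite_index H := finite_set (range (right_coset H)).

Definition fi_subgroup H := group_closed [in H] /\ finite_index H.

Definition right_transversal H (T : set G) :=
  forall g, exists! p : G * G, [/\ H p.1, T p.2 & g = p.1 * p.2].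

Lemma subgroupP H : group_closed [in H] <->
  H 1 /\ (forall x y, H x -> H y -> H (x * y^-1)).
Proof.
split=> [[H1 HD]|[H1 HD]]; split=> [|x y].
- exact: set_mem.
- by move=> Hx Hy; apply: set_mem; apply: HD; apply: mem_set.
- exact: mem_set.
- by move=> /set_mem Hx /set_mem Hy; apply: mem_set; apply: HD.
Qed.

Lemma sub1g H : group_closed [in H] -> H 1.
Proof. by move=> /subgroupP[]. Qed.

Lemma subD H x y : group_closed [in H] -> H x -> H y -> H (x * y^-1).
Proof. by move=> /subgroupP[_]; apply. Qed.

Lemma subV H x : group_closed [in H] -> H x -> H x^-1.
Proof. by move=> HG Hx; rewrite -[_^-1]mul1g; apply: subD => //; apply: sub1g. Qed.

Lemma subM H x y : group_closed [in H] -> H x -> H y -> H (x * y).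
Proof. by move=> HG Hx Hy; rewrite -[y]invgK; apply: subD => //; apply: subV. Qed.

Lemma right_coset_eq H x y : group_closed [in H] ->
  right_coset H x = right_coset H y <-> H (x * y^-1).
Proof.
move=> HG; split=> [E|Hxy].
  have : right_coset H x x by exists 1; [exact: sub1g|rewrite mul1g].
  by rewrite E => -[h Hh <-]; rewrite -mulgA mulgV mulg1.
apply/seteqP; split=> _ [h Hh <-].
- by exists (h * (x * y^-1)); [exact: subM|rewrite -!mulgA mulVg mulg1].
- exists (h * (x * y^-1)^-1); first exact: subD.
  by rewrite invgM invgK -!mulgA mulVg mulg1.
Qed.

Lemma fi_of_labels (L : Type) (F : G -> L) H : group_closed [in H] ->
  finite_set (range F) -> (forall x y, F x = F y -> H (x * y^-1)) ->
  fi_subgroup H.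
Proof.
move=> HG finF FH; split=> //; rewrite /finite_index.
pose k (u : L) := right_coset H (xget 1 (F @^-1` [set u])).
have -> : range (right_coset H) = k @` range F.
  have kF g : k (F g) = right_coset H g.
    apply/right_coset_eq => //; apply: FH.
    by case: xgetP => [z _ <-|/(_ g)] //=.
  apply/seteqP; split=> [_ [g _ <-]|_ [_ [g _ <-] <-]].
    by exists (F g) => //; exists g.
  by exists g.
exact: finite_image.
Qed.

Lemma fi_setT : fi_subgroup setT.
Proof.
by apply: (@fi_of_labels unit (fun=> tt)) => //; apply/subgroupP.
Qed.

(* Canonical choice of a right transversal; the coset of 1 is represented
   by 1. *)
Definition rep H g : G :=
  if pselect (H g) then 1 else xget 1 (right_coset H g).

Definition std_transversal H : set G := range (rep H).

Lemma rep1 H g : H g -> rep H g = 1.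
Proof. by rewrite /rep; case: pselect. Qed.

Lemma repP H g : group_closed [in H] -> H (g * (rep H g)^-1).
Proof.
move=> HG; rewrite /rep; case: pselect => [Hg|nHg].
  by rewrite invg1 mulg1.
case: xgetP => [z _ [h Hh <-]|/(_ g) []].
  by rewrite invgM mulgA mulgV mul1g; apply: subV.
by exists 1; [exact: sub1g|rewrite mul1g].
Qed.

Lemma rep_eq H x y : group_closed [in H] -> H (x * y^-1) -> rep H x = rep H y.
Proof.
move=> HG Hxy; have E := (right_coset_eq x y HG).2 Hxy; rewrite /rep E.
have -> : H x = H y; last by [].
apply/propext; split=> Hz.
  rewrite -[y]invgK -[y^-1]mul1g -(mulVg x) -mulgA.
  by apply: subV => //; apply: subM => //; apply: subV.
by rewrite -[x]mulg1 -(mulVg y) mulgA; apply: subM.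
Qed.

Lemma rep_fin H : fi_subgroup H -> finite_set (range (rep H)).
Proof.
move=> [HG fH].
pose k (A : set G) := rep H (xget 1 A).
have -> : range (rep H) = k @` range (right_coset H).
  have kF g : k (right_coset H g) = rep H g.
    apply: rep_eq => //; case: xgetP => [z _ [h Hh <-]|/(_ g) []].
      by rewrite -mulgA mulgV mulg1.
    by exists 1; [exact: sub1g|rewrite mul1g].
  apply/seteqP; split=> [_ [g _ <-]|_ [_ [g _ <-] <-]].
    by exists (right_coset H g) => //; exists g.
  by exists g.
exact: finite_image.
Qed.

Lemma rep_inj H x y : group_closed [in H] -> rep H x = rep H y -> H (x * y^-1).
Proof.
move=> LG E; have := subD LG (repP x LG) (repP y LG).
by rewrite E invgM invgK -mulgA mulKg.
Qed.

Lemma fi_setI H K : fi_subgroup H -> fi_subgroup K -> fi_subgroup (H `&` K).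
Proof.
move=> fH fK; have [HG _] := fH; have [KG _] := fK.
apply: (@fi_of_labels _ (fun g => (rep H g, rep K g))).
- apply/subgroupP; split=> [|x y [? ?] [? ?]]; first by split; apply: sub1g.
  by split; apply: subD.
- apply: sub_finite_set (finite_setX (rep_fin fH) (rep_fin fK)).
  by move=> _ [g _ <-]; split; exists g.
- by move=> x y [/(rep_inj fH.1) ? /(rep_inj fK.1) ?].
Qed.

Lemma std_transversalP H : group_closed [in H] ->
  right_transversal H (std_transversal H).
Proof.
move=> HG g; exists (g * (rep H g)^-1, rep H g); split=> /=.
  split; [exact: repP|by exists g|by rewrite -mulgA mulVg mulg1].
have rr x : rep H (rep H x) = rep H x.
  apply: rep_eq => //; have := subV HG (repP x HG).
  by rewrite invgM invgK.
move=> [h t] /= [Hh [x _ <-] ->].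
have -> : rep H (h * rep H x) = rep H x.
  by rewrite -{2}(rr x); apply: rep_eq => //; rewrite -mulgA mulgV mulg1.
by rewrite -mulgA mulgV mulg1.
Qed.

Lemma std_transversal1 H : group_closed [in H] -> std_transversal H 1.
Proof. by move=> HG; exists 1 => //; rewrite rep1 //; apply: sub1g. Qed.

(* The [H]-component [h] of [g = h * t]. *)
Definition hpart H (T : set G) g : G := xget 1 [set h | H h /\ T (h^-1 * g)].

Lemma hpartP H T g : right_transversal H T ->
  H (hpart H T g) /\ T ((hpart H T g)^-1 * g).
Proof.
move=> /(_ g)[[h t] [[/= Hh Tt E] _]]; rewrite /hpart.
case: xgetP => [z _ //|/(_ h) []]; split=> //.
by rewrite E mulKg.
Qed.

Lemma hpartM H T h t : right_transversal H T -> H h -> T t ->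
  hpart H T (h * t) = h.
Proof.
move=> HT Hh Tt; have [H1 T1] := hpartP (h * t) HT.
have [p [_ U]] := HT (h * t).
have E1 : p = (h, t) by apply: U.
have E2 : p = (hpart H T (h * t), (hpart H T (h * t))^-1 * (h * t)).
  by apply: U; split=> //=; rewrite mulVKg.
by move: E2; rewrite E1 => -[<-].
Qed.

Lemma transversal_fin H T : fi_subgroup H -> right_transversal H T ->
  finite_set T.
Proof.
move=> [HG fH] HT.
pose k (A : set G) := xget 1 (A `&` T).
suff sT : T `<=` k @` range (right_coset H).
  exact: sub_finite_set sT (finite_image _ fH).
move=> t Tt; exists (right_coset H t); first by exists t.
rewrite /k; case: xgetP => [z _ [[h Hh E] Tz]|/(_ t) []]; last first.
  by split=> //; exists 1; [exact: sub1g|rewrite mul1g].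
have [p [_ U]] := HT z.
have E1 : p = (h, t) by apply: U.
have E2 : p = (1, z).
  by apply: U; split=> //=; [exact: sub1g|rewrite mul1g].
by move: E2; rewrite E1 => -[].
Qed.

End FiniteIndex.

(* An isomorphism between two subgroups of finite index of [G].  Only the
   values of the underlying function on [fi_dom] are meaningful; [fi_equiv]
   ignores the others. *)
Record fi_iso (G : groupType) := FiIso {
  fi_dom : set G;
  fi_cod : set G;
  fi_fun :> G -> G;
  fi_domP : fi_subgroup fi_dom;
  fi_codP : fi_subgroup fi_cod;
  fi_morph : {in fi_dom &, {morph fi_fun : x y / x * y}};
  fi_bij : set_bij fi_dom fi_cod fi_fun
}.

HB.instance Definition _ G := gen_eqMixin (fi_iso G).
HB.instance Definition _ G := gen_choiceMixin (fi_iso G).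

Section Comm.
Variable G : groupType.
Implicit Types (a b c : fi_iso G) (H K : set G).

Definition fi_equiv : rel (fi_iso G) := fun a b =>
  `[< exists H, [/\ fi_subgroup H, H `<=` fi_dom a `&` fi_dom b
                  & {in H, a =1 b}] >].

Lemma fi_equiv_refl : reflexive fi_equiv.
Proof.
by move=> a; apply/asboolP; exists (fi_dom a); split=> //; apply: fi_domP.
Qed.

Lemma fi_equiv_sym : symmetric fi_equiv.
Proof.
have S a b : fi_equiv a b -> fi_equiv b a.
  move=> /asboolP[H [fH sH E]]; apply/asboolP; exists H; split=> //.
    by rewrite setIC.
  by move=> x Hx; rewrite E.
by move=> a b; apply/idP/idP; apply: S.
Qed.

Lemma fi_equiv_trans : transitive fi_equiv.
Proof.
move=> b a c /asboolP[H [fH sH E]] /asboolP[K [fK sK E']].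
apply/asboolP; exists (H `&` K); split; first exact: fi_setI.
  by move=> x [/sH[? ?] /sK[? ?]].
by move=> x /set_mem [Hx Kx]; rewrite E ?E' //; apply: mem_set.
Qed.

Definition fi_equiv_rel : equiv_rel (fi_iso G) :=
  EquivRel fi_equiv fi_equiv_refl fi_equiv_sym fi_equiv_trans.

Definition Comm : Type := {eq_quot fi_equiv_rel}.
HB.instance Definition _ := Choice.on Comm.
HB.instance Definition _ := Quotient.on Comm.
HB.instance Definition _ := EqQuotient.on Comm.

Lemma fi_equiv_agree a b :
  (forall x, fi_dom a x -> fi_dom b x -> a x = b x) -> fi_equiv a b.
Proof.
move=> E; apply/asboolP; exists (fi_dom a `&` fi_dom b); split=> //.
  by apply: fi_setI; apply: fi_domP.
by move=> x /set_mem[]; apply: E.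
Qed.

Lemma fi_m a x y : fi_dom a x -> fi_dom a y -> a (x * y) = a x * a y.
Proof. by move=> ? ?; apply: fi_morph; apply: mem_set. Qed.

Lemma fi_domG a : group_closed [in fi_dom a].
Proof. by have [] := fi_domP a. Qed.

Lemma fi_codG a : group_closed [in fi_cod a].
Proof. by have [] := fi_codP a. Qed.

Lemma fi_1 a : a 1 = 1.
Proof.
apply: (mulgI (a 1)); have H1 := sub1g (fi_domG a).
by rewrite -fi_m // !mulg1.
Qed.

Lemma fi_V a x : fi_dom a x -> a x^-1 = (a x)^-1.
Proof.
move=> Hx; have HV := subV (fi_domG a) Hx.
by apply: (mulgI (a x)); rewrite -fi_m // !mulgV fi_1.
Qed.

Lemma fi_D a x y : fi_dom a x -> fi_dom a y -> a (x * y^-1) = a x * (a y)^-1.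
Proof. by move=> ? ?; rewrite fi_m ?fi_V //; apply: subV => //; apply: fi_domG. Qed.

Lemma fi_in a x : fi_dom a x -> fi_cod a (a x).
Proof. by have [+ _ _] := fi_bij a; apply. Qed.

Lemma fi_preimage a K : fi_subgroup K ->
  fi_subgroup (fi_dom a `&` a @^-1` K).
Proof.
move=> fK; have KG := fK.1; have aG := fi_domG a.
pose h g := g * (rep (fi_dom a) g)^-1.
apply: (@fi_of_labels _ _ (fun g => (rep (fi_dom a) g, rep K (a (h g))))).
- apply/subgroupP; split.
    by split; [exact: sub1g|rewrite /= fi_1; apply: sub1g].
  move=> x y [ax Kx] [ay Ky]; split; first exact: subD.
  by rewrite /= fi_D //; apply: subD.
- apply: sub_finite_set (finite_setX (rep_fin (fi_domP a)) (rep_fin fK)).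
  by move=> _ [g _ <-]; split; [exists g|exists (a (h g))].
- move=> x y [E /(rep_inj KG)].
  have hx : fi_dom a (h x) by exact: repP.
  have hy : fi_dom a (h y) by exact: repP.
  have hxy : h x * (h y)^-1 = x * y^-1.
    by rewrite /h E invgM invgK -mulgA mulKg.
  rewrite -fi_D // hxy => Kxy; split=> //.
  by rewrite -hxy; apply: subD.
Qed.

Definition fi_inv_fun a y := xget 1 (fi_dom a `&` a @^-1` [set y]).

Lemma fi_inv_funP a y : fi_cod a y ->
  fi_dom a (fi_inv_fun a y) /\ a (fi_inv_fun a y) = y.
Proof.
have [_ _ s] := fi_bij a => /s [x ax E]; rewrite /fi_inv_fun.
by case: xgetP => [z _ [? ?] //|/(_ x) []].
Qed.

Lemma fi_inj a x y : fi_dom a x -> fi_dom a y -> a x = a y -> x = y.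
Proof. by have [_ i _] := fi_bij a => ? ?; apply: i; apply: mem_set. Qed.

Lemma fi_inv_funK a x : fi_dom a x -> fi_inv_fun a (a x) = x.
Proof.
move=> ax; have [d E] := fi_inv_funP (fi_in ax).
exact: fi_inj E.
Qed.

Lemma fi_inv_morph a :
  {in fi_cod a &, {morph fi_inv_fun a : x y / x * y}}.
Proof.
move=> x y /set_mem cx /set_mem cy.
have [dx Ex] := fi_inv_funP cx; have [dy Ey] := fi_inv_funP cy.
rewrite -{1}Ex -{1}Ey -fi_m // fi_inv_funK //.
by apply: subM => //; apply: fi_domG.
Qed.

Lemma fi_inv_bij a : set_bij (fi_cod a) (fi_dom a) (fi_inv_fun a).
Proof.
split=> [y /fi_inv_funP[] //|x y /set_mem cx /set_mem cy E|x ax].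
  by rewrite -(fi_inv_funP cx).2 E (fi_inv_funP cy).2.
by exists (a x); [exact: fi_in|exact: fi_inv_funK].
Qed.

Definition fi_inv a : fi_iso G :=
  FiIso (fi_codP a) (fi_domP a) (@fi_inv_morph a) (fi_inv_bij a).

(* [fi_dom a] occurs explicitly in the domain because [a @^-1` _] also
   contains points at which the value of [a] is meaningless. *)
Definition mul_dom a b : set G :=
  fi_dom a `&` a @^-1` (fi_cod a `&` fi_dom b).

Definition mul_cod a b : set G := b @` (fi_cod a `&` fi_dom b).

Lemma mul_domP a b : fi_subgroup (mul_dom a b).
Proof. by apply: fi_preimage; apply: fi_setI; [exact: fi_codP|exact: fi_domP]. Qed.

Lemma mul_codP a b : fi_subgroup (mul_cod a b).
Proof.
have -> : mul_cod a b =
    fi_dom (fi_inv b) `&` fi_inv b @^-1` (fi_cod a `&` fi_dom b).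
  apply/seteqP; split=> [_ [x [ax bx] <-]|x [/= cx [ax bx]]].
    by split; [exact: fi_in|rewrite /= fi_inv_funK].
  by exists (fi_inv_fun b x); rewrite ?(fi_inv_funP cx).2.
by apply: fi_preimage; apply: fi_setI; [exact: fi_codP|exact: fi_domP].
Qed.

Lemma mul_morph a b : {in mul_dom a b &, {morph b \o a : x y / x * y}}.
Proof.
move=> x y /set_mem[ax [_ bx]] /set_mem[ay [_ b_y]] /=.
by rewrite fi_m // fi_m.
Qed.

Lemma mul_bij a b : set_bij (mul_dom a b) (mul_cod a b) (b \o a).
Proof.
split.
- by move=> x [ax abx]; exists (a x).
- move=> x y /set_mem[ax [_ bx]] /set_mem[ay [_ b_y]] /= E.
  by apply: (@fi_inj a) => //; apply: (@fi_inj b).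
- move=> _ [y [cy by_] <-]; have [d E] := fi_inv_funP cy.
  by exists (fi_inv_fun a y); rewrite /= ?E //; split=> //=; rewrite E.
Qed.

(* Products are written from left to right: first [a], then [b]. *)
Definition fi_mul a b : fi_iso G :=
  FiIso (mul_domP a b) (mul_codP a b) (@mul_morph a b) (mul_bij a b).

Lemma fi_one_bij : set_bij [set: G] [set: G] id.
Proof. by split=> // x; exists x. Qed.

Definition fi_one : fi_iso G :=
  FiIso (fi_setT G) (fi_setT G) (fun _ _ _ _ => erefl) fi_one_bij.

Lemma fi_mul_equiv a a' b b' :
  fi_equiv a a' -> fi_equiv b b' -> fi_equiv (fi_mul a b) (fi_mul a' b').
Proof.
move=> /asboolP[H [fH sH E]] /asboolP[K [fK sK E']].
apply/asboolP; exists (H `&` (fi_dom a `&` a @^-1` K)); split.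
- by apply: fi_setI => //; apply: fi_preimage.
- move=> x [Hx [ax Kx]]; have [_ a'x] := sH _ Hx.
  have [bx b'x] := sK _ Kx; have Ex := E x (mem_set Hx).
  split; (split=> //; split=> //); rewrite /= -?Ex //; last rewrite Ex.
    exact: fi_in.
  exact: fi_in.
- move=> x /set_mem[Hx [ax Kx]] /=.
  by rewrite -(E x (mem_set Hx)) E' //; apply: mem_set.
Qed.

Lemma pi_commE a b : \pi_Comm a = \pi_Comm b <-> fi_equiv a b.
Proof. by split=> [/eqquotP|?] //; apply/eqquotP. Qed.

Definition comm_mul (x y : Comm) : Comm := \pi_Comm (fi_mul (repr x) (repr y)).
Definition comm_one : Comm := \pi_Comm fi_one.
Definition comm_inv (x : Comm) : Comm := \pi_Comm (fi_inv (repr x)).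

Lemma comm_mul_pi a b :
  comm_mul (\pi_Comm a) (\pi_Comm b) = \pi_Comm (fi_mul a b).
Proof.
by apply/pi_commE/fi_mul_equiv; apply/pi_commE; rewrite reprK.
Qed.

Lemma comm_mulA : associative comm_mul.
Proof.
elim/quotW=> a; elim/quotW=> b; elim/quotW=> c.
rewrite (comm_mul_pi b c) (comm_mul_pi a b) !comm_mul_pi.
by apply/pi_commE; apply: fi_equiv_agree => w _ _.
Qed.

Lemma comm_1mul : left_id comm_one comm_mul.
Proof.
elim/quotW=> a; rewrite comm_mul_pi.
by apply/pi_commE; apply: fi_equiv_agree => w _ _.
Qed.

Lemma comm_mul1 : right_id comm_one comm_mul.
Proof.
elim/quotW=> a; rewrite comm_mul_pi.
by apply/pi_commE; apply: fi_equiv_agree => w _ _.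
Qed.

Lemma comm_mulV : right_inverse comm_one comm_inv comm_mul.
Proof.
move=> x; rewrite /comm_inv -{1}[x]reprK comm_mul_pi.
apply/pi_commE/fi_equiv_agree => z /= [az _] _.
exact: fi_inv_funK.
Qed.

Lemma comm_Vmul : left_inverse comm_one comm_inv comm_mul.
Proof.
move=> x; rewrite /comm_inv -{2}[x]reprK comm_mul_pi.
apply/pi_commE/fi_equiv_agree => z /= [az _] _.
by rewrite /= (fi_inv_funP az).2.
Qed.

HB.instance Definition _ := isGroup.Build Comm
  comm_mulA comm_1mul comm_mul1 comm_Vmul comm_mulV.

Lemma CommM a b : \pi_Comm a * \pi_Comm b = \pi_Comm (fi_mul a b).
Proof. exact: comm_mul_pi. Qed.

End Comm.

Section QuasiIsometry.
Variable R : realType.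
Implicit Types X Y Z : metricType R.
Local Open Scope ring_scope.

Definition quasi_isometry X Y (f : X -> Y) := exists K C C0 : R,
  [/\ 0 < K, 0 < C, 0 < C0,
      forall x1 x2 : X,
        K^-1 * mdist x1 x2 - C <= mdist (f x1) (f x2) <= K * mdist x1 x2 + C
    & \bigcup_(x : X) ball (f x) C0 = [set: Y]].

Definition bounded_dist X Y (f g : X -> Y) :=
  exists M : R, 0 < M /\ forall x, mdist (f x) (g x) <= M.

Definition coarse_lipschitz X Y (f : X -> Y) :=
  exists K C : R, [/\ 0 < K, 0 < C
    & forall x1 x2, mdist (f x1) (f x2) <= K * mdist x1 x2 + C].

Lemma bounded_dist_refl X Y (f : X -> Y) : bounded_dist f f.
Proof. by exists 1; split=> // x; rewrite mdistxx. Qed.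

Lemma bounded_dist_sym X Y (f g : X -> Y) :
  bounded_dist f g -> bounded_dist g f.
Proof. by move=> [M [M0 H]]; exists M; split=> // x; rewrite metric_sym. Qed.

Lemma bounded_dist_trans X Y (f g h : X -> Y) :
  bounded_dist f g -> bounded_dist g h -> bounded_dist f h.
Proof.
move=> [M [M0 H]] [N [N0 H']]; exists (M + N); split; first exact: addr_gt0.
by move=> x; rewrite (le_trans (metric_triangle _ (g x) _)) // lerD.
Qed.

Lemma bounded_dist_compr X Y Z (f : X -> Y) (g g' : Y -> Z) :
  bounded_dist g g' -> bounded_dist (g \o f) (g' \o f).
Proof. by move=> [M [M0 H]]; exists M; split=> // x /=. Qed.

Lemma bounded_dist_compl X Y Z (f f' : X -> Y) (g : Y -> Z) :
  coarse_lipschitz g -> bounded_dist f f' -> bounded_dist (g \o f) (g \o f').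
Proof.
move=> [K [C [K0 C0 gL]]] [M [M0 H]]; exists (K * M + C).
split=> [|x /=]; first by rewrite addr_gt0 ?mulr_gt0.
by rewrite (le_trans (gL _ _)) // lerD2r ler_pM2l.
Qed.

Lemma coarse_lipschitz_comp X Y Z (f : X -> Y) (g : Y -> Z) :
  coarse_lipschitz f -> coarse_lipschitz g -> coarse_lipschitz (g \o f).
Proof.
move=> [K [C [K0 C0 fL]]] [L [D [L0 D0 gL]]].
exists (L * K), (L * C + D); split; rewrite ?addr_gt0 ?mulr_gt0 // => x y /=.
by rewrite (le_trans (gL _ _)) // addrA lerD2r -mulrA -mulrDr ler_pM2l.
Qed.

Lemma quasi_isometry_lip X Y (f : X -> Y) :
  quasi_isometry f -> coarse_lipschitz f.
Proof.
move=> [K [C [C0 [K0 C_0 _ H _]]]]; exists K, C; split=> // x y.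
by have /andP[] := H x y.
Qed.

Lemma quasi_isometryP X (f : X -> X) : quasi_isometry f <->
  coarse_lipschitz f /\ exists g : X -> X,
    [/\ coarse_lipschitz g, bounded_dist (g \o f) id & bounded_dist (f \o g) id].
Proof.
split=> [fQ|[[K [C [K0 C0 fL]]]] [g [[L [D [L0 D0 gL]]] [M [M0 gf]] [N [N0 fg]]]]].
  split; first exact: quasi_isometry_lip.
  case: fQ => K [C [C0 [K0 Cp C0p H S]]].
  have ex y : exists x, mdist (f x) y < C0.
    have : [set: X] y by [].
    by rewrite -S => -[x _]; rewrite ballEmdist; exists x.
  have [g gP] := choice ex.
  have fg y : mdist (f (g y)) y <= C0 by rewrite ltW.
  exists g; split.
  - exists K, (K * (C0 + C0 + C)); split=> //.
      by rewrite mulr_gt0 // !addr_gt0.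
    move=> x y; have /andP[h _] := H (g x) (g y).
    rewrite -mulrDr -ler_pdivrMl //.
    have h1 := fg x; have h2 := fg y.
    have h3 := metric_triangle (f (g x)) x (f (g y)).
    have h4 := metric_triangle x y (f (g y)).
    rewrite (metric_sym y) in h4; lra.
  - exists (K * (C0 + C)); split; first by rewrite mulr_gt0 // addr_gt0.
    move=> x; have /andP[h _] := H (g (f x)) x.
    by rewrite -ler_pdivrMl //=; have := fg (f x); lra.
  - by exists C0.
exists (K + L), (C + L^-1 * (D + 2 * M)), (N + 1); split.
- exact: addr_gt0.
- by rewrite addr_gt0 ?mulr_gt0 ?invr_gt0 ?addr_gt0 ?mulr_gt0.
- by rewrite addr_gt0.
- move=> x y; apply/andP; split.
    have d0 : 0 <= mdist x y := mdist_ge0 x y.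
    have h : mdist x y <= L * mdist (f x) (f y) + (D + 2 * M).
      have h1 := gL (f x) (f y).
      have h2 : mdist (g (f x)) x <= M := gf x.
      have h3 : mdist (g (f y)) y <= M := gf y.
      have h4 := metric_triangle x (g (f x)) y.
      have h5 := metric_triangle (g (f x)) (g (f y)) y.
      rewrite metric_sym in h2.
      lra.
    rewrite lerBlDr; apply: (@le_trans _ _ (L^-1 * mdist x y)).
      by rewrite ler_wpM2r // lef_pV2 ?posrE ?addr_gt0 // lerDr ltW.
    rewrite mulrC ler_pdivrMr // [leRHS]mulrC !(mulrDr L).
    rewrite (mulrA L L^-1) mulfV ?gt_eqF // mul1r.
    have := mulr_gt0 L0 C0; lra.
  apply: (le_trans (fL x y)); apply: lerD.
    by rewrite ler_wpM2r ?mdist_ge0 // lerDl ltW.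
  by rewrite lerDl mulr_ge0 ?invr_ge0 ?addr_ge0 ?mulr_ge0 // ltW.
- apply/seteqP; split=> // y _; exists (g y) => //; rewrite ballEmdist /=.
  by rewrite (le_lt_trans (fg y)) // ltrDl.
Qed.

Lemma quasi_isometry_comp X (f g : X -> X) :
  quasi_isometry f -> quasi_isometry g -> quasi_isometry (g \o f).
Proof.
move=> /quasi_isometryP[fL [f' [f'L ff f'f]]].
move=> /quasi_isometryP[gL [g' [g'L gg g'g]]].
apply/quasi_isometryP; split; first exact: coarse_lipschitz_comp.
exists (f' \o g'); split; first exact: coarse_lipschitz_comp.
- apply: bounded_dist_trans ff.
  apply: (@bounded_dist_compl _ _ _ (g' \o (g \o f)) f f') => //.
  exact: (@bounded_dist_compr _ _ _ f (g' \o g) id).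
- apply: bounded_dist_trans g'g.
  apply: (@bounded_dist_compl _ _ _ (f \o (f' \o g')) g' g) => //.
  exact: (@bounded_dist_compr _ _ _ g' (f \o f') id).
Qed.

Lemma quasi_isometry_id X : quasi_isometry (@id X).
Proof.
apply/quasi_isometryP; split; last exists id.
  by exists 1, 1; split=> // x y; rewrite mul1r lerDl.
split; try exact: bounded_dist_refl.
by exists 1, 1; split=> // x y; rewrite mul1r lerDl.
Qed.

End QuasiIsometry.

Record self_qi (R : realType) (X : metricType R) := SelfQI {
  qi_fun :> X -> X;
  qi_funP : quasi_isometry qi_fun
}.

HB.instance Definition _ R X := gen_eqMixin (@self_qi R X).
HB.instance Definition _ R X := gen_choiceMixin (@self_qi R X).

Section QI.
Variables (R : realType) (X : metricType R).
Implicit Types f g h : self_qi X.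

Definition qi_equiv : rel (self_qi X) := fun f g => `[< bounded_dist f g >].

Lemma qi_equiv_refl : reflexive qi_equiv.
Proof. by move=> f; apply/asboolP; apply: bounded_dist_refl. Qed.

Lemma qi_equiv_sym : symmetric qi_equiv.
Proof.
by move=> f g; apply/asboolP/asboolP; apply: bounded_dist_sym.
Qed.

Lemma qi_equiv_trans : transitive qi_equiv.
Proof.
move=> g f h /asboolP fg /asboolP gh; apply/asboolP.
exact: bounded_dist_trans gh.
Qed.

Definition qi_equiv_rel : equiv_rel (self_qi X) :=
  EquivRel qi_equiv qi_equiv_refl qi_equiv_sym qi_equiv_trans.

Definition QI : Type := {eq_quot qi_equiv_rel}.
HB.instance Definition _ := Choice.on QI.
HB.instance Definition _ := Quotient.on QI.
HB.instance Definition _ := EqQuotient.on QI.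

Lemma pi_QIE f g : \pi_QI f = \pi_QI g <-> bounded_dist f g.
Proof.
split=> [/eqquotP/asboolP //|fg].
by apply/eqquotP/asboolP.
Qed.

(* As in [fi_mul]: first [f], then [g]. *)
Definition qi_mul f g : self_qi X :=
  SelfQI (quasi_isometry_comp (qi_funP f) (qi_funP g)).

Definition qi_one : self_qi X := SelfQI (quasi_isometry_id X).

Lemma qi_inv_ex f :
  exists g : self_qi X, bounded_dist (g \o f) id /\ bounded_dist (f \o g) id.
Proof.
have [fL [g [gL gf fg]]] := (quasi_isometryP f).1 (qi_funP f).
have gQ : quasi_isometry g by apply/quasi_isometryP; split=> //; exists f.
by exists (SelfQI gQ).
Qed.

Definition qi_inv f : self_qi X := projT1 (cid (qi_inv_ex f)).

Definition QI_mul (x y : QI) : QI := \pi_QI (qi_mul (repr x) (repr y)).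
Definition QI_one : QI := \pi_QI qi_one.
Definition QI_inv (x : QI) : QI := \pi_QI (qi_inv (repr x)).

Lemma QI_mul_pi f g : QI_mul (\pi_QI f) (\pi_QI g) = \pi_QI (qi_mul f g).
Proof.
apply/pi_QIE.
have ff : bounded_dist (repr (\pi_QI f)) f by apply/pi_QIE; rewrite reprK.
have gg : bounded_dist (repr (\pi_QI g)) g by apply/pi_QIE; rewrite reprK.
apply: (@bounded_dist_trans _ _ _ _ (repr (\pi_QI g) \o f)).
  by apply: bounded_dist_compl => //; apply: quasi_isometry_lip (qi_funP _).
exact: (@bounded_dist_compr _ _ _ _ f).
Qed.

Lemma QI_mulA : associative QI_mul.
Proof.
elim/quotW=> a; elim/quotW=> b; elim/quotW=> c.
rewrite (QI_mul_pi b c) (QI_mul_pi a b) !QI_mul_pi.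
by apply/pi_QIE; apply: bounded_dist_refl.
Qed.

Lemma QI_1mul : left_id QI_one QI_mul.
Proof.
elim/quotW=> a; rewrite QI_mul_pi.
by apply/pi_QIE; apply: bounded_dist_refl.
Qed.

Lemma QI_mul1 : right_id QI_one QI_mul.
Proof.
elim/quotW=> a; rewrite QI_mul_pi.
by apply/pi_QIE; apply: bounded_dist_refl.
Qed.

Lemma QI_mulV : right_inverse QI_one QI_inv QI_mul.
Proof.
move=> x; rewrite /QI_inv -{1}[x]reprK QI_mul_pi; apply/pi_QIE.
by rewrite /qi_inv; case: cid => g [].
Qed.

Lemma QI_Vmul : left_inverse QI_one QI_inv QI_mul.
Proof.
move=> x; rewrite /QI_inv -{2}[x]reprK QI_mul_pi; apply/pi_QIE.
by rewrite /qi_inv; case: cid => g [].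
Qed.

HB.instance Definition _ := isGroup.Build QI
  QI_mulA QI_1mul QI_mul1 QI_Vmul QI_mulV.

Lemma QIM f g : \pi_QI f * \pi_QI g = \pi_QI (qi_mul f g).
Proof. exact: QI_mul_pi. Qed.

End QI.

Section WordLength.
Variables (G : groupType) (S : seq G).

Definition is_word (w : seq G) := all (fun s => (s \in S) || (s^-1 \in S)) w.

Definition generates := forall g : G,
  exists2 w : seq G, is_word w & g = \prod_(s <- w) s.

Hypothesis genS : generates.

Lemma word_ex (g : G) : exists k : nat, `[< exists w : seq G,
  [/\ is_word w, size w = k & g = \prod_(s <- w) s] >].
Proof.
by have [w ww E] := genS g; exists (size w); apply/asboolP; exists w.
Qed.

Definition word_length (g : G) : nat := ex_minn (word_ex g).

Lemma word_lengthP g : exists w : seq G,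
  [/\ is_word w, size w = word_length g & g = \prod_(s <- w) s].
Proof. by rewrite /word_length; case: ex_minnP => m /asboolP. Qed.

Lemma word_length_le w : is_word w ->
  (word_length (\prod_(s <- w) s) <= size w)%N.
Proof.
move=> ww; rewrite /word_length; case: ex_minnP => m _; apply.
by apply/asboolP; exists w.
Qed.

Lemma word_length1 : word_length 1 = 0%N.
Proof.
apply/eqP; rewrite -leqn0.
by have := @word_length_le [::] isT; rewrite big_nil.
Qed.

Lemma word_length0 g : word_length g = 0%N -> g = 1.
Proof.
move=> E; have [w [_ + ->]] := word_lengthP g.
by rewrite E => /size0nil ->; rewrite big_nil.
Qed.

Lemma word_lengthM g h :
  (word_length (g * h) <= word_length g + word_length h)%N.
Proof.
have [w [ww <- Eg]] := word_lengthP g; have [v [wv <- Eh]] := word_lengthP h.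
rewrite {1}Eg {1}Eh -big_cat -size_cat; apply: word_length_le.
by rewrite /is_word all_cat; apply/andP.
Qed.

Lemma word_prodV (w : seq G) :
  (\prod_(s <- w) s)^-1 = \prod_(s <- rev (map (fun s : G => s^-1) w)) s.
Proof.
elim: w => [|s w IH]; first by rewrite !big_nil invg1.
by rewrite big_cons invgM IH /= rev_cons -cats1 big_cat big_seq1.
Qed.

Lemma word_lengthV g : word_length g^-1 = word_length g.
Proof.
suff le x : (word_length x^-1 <= word_length x)%N.
  by apply/eqP; rewrite eqn_leq le -{1}[g]invgK le.
have [w [ww <- {1}->]] := word_lengthP x.
rewrite word_prodV -(size_map (fun s : G => s^-1)) -size_rev; apply: word_length_le.
rewrite /is_word all_rev all_map; apply: sub_all ww => s /=.
by rewrite invgK orbC.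
Qed.

End WordLength.

(* A copy of [G] carrying the word metric of the generating sequence [S]. *)
Definition word_space (R : realType) (G : groupType) (S : seq G)
  (genS : generates S) : Type := G.

Section WordSpace.
Variables (R : realType) (G : groupType) (S : seq G) (genS : generates S).
Local Notation W := (word_space R genS).

HB.instance Definition _ := Choice.on W.

Definition word_dist (x y : W) : R :=
  (word_length genS ((x : G)^-1 * (y : G)))%:R%R.

Lemma word_distxx x : word_dist x x = 0%R.
Proof. by rewrite /word_dist mulVg word_length1. Qed.

Lemma word_dist_eq0 x y : word_dist x y = 0%R -> x = y.
Proof.
move/eqP; rewrite pnatr_eq0 => /eqP/word_length0 E.
by rewrite -[y](mulVKg (x : G)) E mulg1.
Qed.

Lemma word_dist_sym x y : word_dist x y = word_dist y x.
Proof. by rewrite /word_dist -word_lengthV invgM invgK. Qed.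

Lemma word_dist_triangle y x z :
  (word_dist x z <= word_dist x y + word_dist y z)%R.
Proof.
rewrite -natrD ler_nat; apply: leq_trans (word_lengthM _ _ _).
by rewrite -mulgA mulVKg.
Qed.

HB.instance Definition _ := isMetric.Build R W
  word_distxx word_dist_eq0 word_dist_sym word_dist_triangle.

Lemma word_mdistE (x y : W) :
  mdist x y = (word_length genS ((x : G)^-1 * (y : G)))%:R%R.
Proof. by []. Qed.

Definition transversal_map (a : fi_iso G) (T : set G) : W -> W :=
  fun g => a (hpart (fi_dom a) T g).

Lemma transversal_mapE a T h t : right_transversal (fi_dom a) T ->
  fi_dom a h -> T t -> transversal_map a T (h * t) = a h.
Proof. by move=> HT Hh Tt; rewrite /transversal_map hpartM. Qed.

Lemma transversal_map_id a T h : right_transversal (fi_dom a) T -> T 1 ->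
  fi_dom a h -> transversal_map a T h = a h.
Proof. by move=> HT T1 Hh; rewrite -[h in LHS]mulg1 transversal_mapE. Qed.

Lemma finite_bound (A : set G) : finite_set A ->
  exists n : nat, forall x, A x -> (word_length genS x <= n)%N.
Proof.
move=> /finite_seqP[s ->].
exists (\max_(x <- s) word_length genS x)%N => x /= xs.
exact: leq_bigmax_seq.
Qed.

Lemma hpart_close (H T : set G) : fi_subgroup H -> right_transversal H T ->
  exists M : R, (0 < M)%R /\
    forall g : W, (mdist (hpart H T g : W) g <= M)%R.
Proof.
move=> fH HT; have [n nP] := finite_bound (transversal_fin fH HT).
exists n.+1%:R%R; split=> [|g]; first by rewrite ltr0n.
rewrite word_mdistE ler_nat; apply: leqW; apply: nP.
by have [] := hpartP g HT.
Qed.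

Lemma transversal_map_lip a T : right_transversal (fi_dom a) T -> T 1 ->
  coarse_lipschitz (transversal_map a T).
Proof.
move=> HT T1; set H := fi_dom a; have HG : group_closed [in H] := fi_domG a.
have finT := transversal_fin (fi_domP a) HT.
pose F : G -> G := transversal_map a T.
pose step (p : G * G) := a (hpart H T (p.1 * p.2)).
pose SS := [set` S ++ map (fun s : G => s^-1) S].
have finSS : finite_set SS by exact: finite_seq.
have [n nP] := finite_bound (finite_image step (finite_setX finT finSS)).
have hM h g : H h -> hpart H T (h * g) = h * hpart H T g.
  move=> Hh; have [Hg Tg] := hpartP g HT.
  by rewrite -{1}(mulVKg (hpart H T g) g) mulgA hpartM //; apply: subM.
have one s (x : G) : (s \in S) || (s^-1 \in S) ->
    (word_length genS ((F x)^-1 * F (x * s)%g) <= n)%N.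
  move=> sS; have [Hx Tx] := hpartP x HT.
  have -> : (F x)^-1 * F (x * s) = step ((hpart H T x)^-1 * x, s).
    have [Hy _] := hpartP ((hpart H T x)^-1 * (x * s)) HT.
    rewrite /step /F /transversal_map /= -mulgA.
    rewrite -[in x * s](mulVKg (hpart H T x) (x * s)).
    by rewrite -/H hM // fi_m // !mulKg.
  apply: nP; exists ((hpart H T x)^-1 * x, s) => //; split=> //=.
  rewrite /SS /= mem_cat; case/orP: sS => [->//|sS].
  by apply/orP; right; apply/mapP; exists s^-1; rewrite ?invgK.
exists n.+1%:R%R, 1%R; split; rewrite ?ltr0n // => x y.
have main w : is_word S w -> forall x : G,
    (word_length genS ((F x)^-1 * F (x * \prod_(s <- w) s)%g) <= n * size w)%N.
  elim: w => [_ z|s w IH /andP[sS ww] z].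
    by rewrite big_nil mulg1 mulVg word_length1.
  rewrite big_cons mulgA /= mulnS.
  have -> : (F z)^-1 * F (z * s * \prod_(j <- w) j) =
    ((F z)^-1 * F (z * s)) * ((F (z * s))^-1 * F (z * s * \prod_(j <- w) j)).
    by rewrite mulgA mulgK.
  apply: leq_trans (word_lengthM _ _ _) _.
  by apply: leq_add; [exact: one|exact: IH].
have [w [ww sw E]] := word_lengthP genS ((x : G)^-1 * (y : G)).
have := main w ww x; rewrite -E mulVKg sw => le1.
rewrite !word_mdistE -natrM natr1 ler_nat.
by apply: leq_trans le1 _; rewrite leqW // leq_mul2r leqnSn orbT.
Qed.

Lemma transversal_map_qi a T : right_transversal (fi_dom a) T -> T 1 ->
  quasi_isometry (transversal_map a T).
Proof.
move=> HT T1; apply/quasi_isometryP; split; first exact: transversal_map_lip.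
have bG := fi_domG (fi_inv a).
have BT := std_transversalP bG; have B1 := std_transversal1 bG.
set T' := std_transversal _ in BT B1.
exists (transversal_map (fi_inv a) T'); split.
- exact: transversal_map_lip.
- have [M [M0 MP]] := hpart_close (fi_domP a) HT.
  exists M; split=> // g; rewrite compE.
  have [Hg _] := hpartP g HT.
  rewrite (transversal_map_id BT B1); last exact: (fi_in Hg).
  by rewrite /= fi_inv_funK.
- have [M [M0 MP]] := hpart_close (fi_domP (fi_inv a)) BT.
  exists M; split=> // g; rewrite compE.
  have [Hg _] := hpartP g BT.
  have [aHg E] := fi_inv_funP Hg.
  by rewrite (transversal_map_id HT T1 aHg) E.
Qed.

Definition transversal_qi a T (HT : right_transversal (fi_dom a) T)
  (T1 : T 1) : self_qi W := SelfQI (transversal_map_qi HT T1).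

(* The representative of the class and the transversal are fixed by choice;
   [LambdaE] shows that the value does not depend on them. *)
Definition Lambda (c : Comm G) : QI W :=
  \pi_(QI W) (transversal_qi (std_transversalP (fi_domG (repr c)))
                             (std_transversal1 (fi_domG (repr c)))).

Lemma transversal_map_equiv a b T U :
  right_transversal (fi_dom a) T -> T 1 ->
  right_transversal (fi_dom b) U -> U 1 ->
  fi_equiv a b ->
  bounded_dist (transversal_map a T) (transversal_map b U).
Proof.
move=> HT T1 HU U1 /asboolP[K [fK sK E]]; have KG := fK.1.
have KT := std_transversalP KG.
set V := std_transversal K in KT.
pose p (g : W) : W := hpart K V g.
have pK g : K (p g) by have [] := hpartP g KT.
have [M [M0 MP]] := hpart_close fK KT.
have pid : bounded_dist id p.
  by exists M; split=> // g; rewrite metric_sym; apply: MP.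
have la := bounded_dist_compl (transversal_map_lip HT T1) pid.
have lb := bounded_dist_compl (transversal_map_lip HU U1) pid.
apply: bounded_dist_trans la _; apply: bounded_dist_sym.
apply: bounded_dist_trans lb _.
have -> : transversal_map b U \o p = transversal_map a T \o p.
  apply/funext => g /=; have [ap bp] := sK _ (pK g).
  by rewrite !transversal_map_id // E //; apply: mem_set.
exact: bounded_dist_refl.
Qed.

Lemma LambdaE a T (HT : right_transversal (fi_dom a) T) (T1 : T 1) :
  Lambda (\pi_(Comm G) a) = \pi_(QI W) (transversal_qi HT T1).
Proof.
apply/pi_QIE; apply: transversal_map_equiv => //.
- exact: std_transversalP (fi_domG _).
- exact: std_transversal1 (fi_domG _).
- by apply/pi_commE; rewrite reprK.
Qed.

End WordSpace.

Arguments Lambda R {G S} genS c.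

(* Main.v *)
Require Import Defs.
From mathcomp Require Import all_boot all_order all_algebra reals.
From mathcomp Require Import boolp classical_sets cardinality topology.

(** Multiplicativity and injectivity of [Lambda] both come from looking at
    the representatives of the classes on a common subgroup of finite index.

    Multiplicativity: a subgroup [H] of finite index is coarsely dense in
    [G], so a coarsely Lipschitz map is determined up to bounded distance by
    its restriction to [H] ([bounded_dist_of_agree]).  The map attached to a
    product of two commensurations and the composite of the two maps attached
    to the factors coincide on the domain of the product.

    Injectivity: suppose that the maps attached to [a] and [b] are at distance
    at most [M], and let [h] lie in both domains.  On the powers of [h] this
    says that [(a h) ^- k * (b h) ^+ k] stays, for all [k], in the ball of
    radius [M], which is finite because [G] is finitely generated.  By the
    pigeonhole principle two exponents [k < l] give the same element, whence
    [a h ^+ (l - k) = b h ^+ (l - k)], and unique roots give [a h = b h].  So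
    [a] and [b] agree wherever both are defined. *)

Set Implicit Arguments.
Unset Strict Implicit.
Unset Printing Implicit Defensive.

Import Order.TTheory Num.Theory.

Local Open Scope classical_set_scope.
Local Open Scope group_scope.

Lemma finite_word_ball (G : groupType) (S : seq G) (genS : generates S)
    (n : nat) : finite_set [set g | (word_length genS g <= n)%N].
Proof.
elim: n => [|n IH].
  apply: sub_finite_set (finite_set1 1) => g /=.
  by rewrite leqn0 => /eqP/word_length0.
(* An element of length at most [n.+1] is a letter times an element of length
   at most [n]; counting [1] as a letter covers the empty word too. *)
have finS := finite_seq (1 :: S ++ map (fun s : G => s^-1) S).
apply: sub_finite_set (finite_image (fun p : G * G => p.1 * p.2)
  (finite_setX finS IH)) => g /= gn.
have [w [+ + Eg]] := word_lengthP genS g.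
case: w Eg gn => [|s w] -> /=.
  rewrite big_nil => _ _ _; exists (1, 1); last by rewrite /= mulg1.
  by split; rewrite /= ?word_length1 // mem_head.
rewrite big_cons => gn /andP[sS ww] sw.
exists (s, \prod_(j <- w) j) => //; split => /=; last first.
  by apply: leq_trans (word_length_le genS ww) _; rewrite -ltnS sw.
rewrite /= inE mem_cat; case/orP: sS => [->|sS]; first by rewrite orbT.
by apply/or3P/Or33/mapP; exists s^-1; rewrite ?invgK.
Qed.

Lemma fi_X (G : groupType) (a : fi_iso G) (h : G) (k : nat) :
  fi_dom a h -> fi_dom a (h ^+ k) /\ a (h ^+ k) = a h ^+ k.
Proof.
move=> ah; elim: k => [|k [IH E]].
  by rewrite !expg0 fi_1; split=> //; apply: sub1g (fi_domG a).
by rewrite !expgS fi_m // E; split=> //; apply: subM => //; apply: fi_domG.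
Qed.

(** If [k < l] give the same element of [B], cancelling [u ^+ k] on the left
    and [v ^+ k] on the right leaves [u ^+ (l - k) = v ^+ (l - k)]; without
    such a coincidence [nat] would embed into the finite set [B]. *)
Lemma unique_root_of_finite (G : groupType) (B : set G) (u v : G) :
  unique_root G -> finite_set B ->
  (forall k, B ((u ^+ k)^-1 * v ^+ k)) -> u = v.
Proof.
move=> root finB uvB; pose f k := (u ^+ k)^-1 * v ^+ k.
have collide k m : f k = f (m.+1 + k)%N -> u = v.
  rewrite /f !expgnDr invgM -!mulgA => /mulgI.
  rewrite mulgA -[LHS]mul1g => /mulIg E.
  apply: (root _ _ m.+1) => //.
  by rewrite -[RHS](mulKg (u ^+ m.+1)^-1) -E invgK mulg1.
apply: contrapT => uv; apply: infinite_nat.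
have fI : {in f @^-1` B &, injective f}.
  move=> k l _ _ fkl; case: (ltngtP k l) => // lt; exfalso; apply: uv.
    by apply: (collide k (l - k.+1)%N); rewrite addSnnS subnK.
  by apply: (collide l (k - l.+1)%N); rewrite addSnnS subnK.
suff <- : f @^-1` B = setT by exact: finite_preimage.
by apply/seteqP; split=> // k _; apply: uvB.
Qed.

Section WordSpace.
Variables (R : realType) (G : groupType) (S : seq G) (genS : generates S).
Local Notation W := (word_space R genS).

(** Sending each point to the [H]-component of its decomposition along a
    transversal is at bounded distance from the identity.  Precomposing with
    it therefore changes [f] and [g] only by a bounded amount, and makes them
    equal. *)
Lemma bounded_dist_of_agree (H : set G) (f g : W -> W) :
  fi_subgroup H -> coarse_lipschitz f -> coarse_lipschitz g ->
  (forall h, H h -> f h = g h) -> bounded_dist f g.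
Proof.
move=> fH fL gL fg; have HT := std_transversalP fH.1.
have [M [M0 MP]] := hpart_close R genS fH HT.
set p : W -> W := hpart H _ in MP.
have pid : bounded_dist id p by exists M; split=> // x; rewrite metric_sym.
apply: bounded_dist_trans (bounded_dist_compl fL pid) _.
apply: bounded_dist_sym; apply: bounded_dist_trans (bounded_dist_compl gL pid) _.
have -> : g \o p = f \o p.
  by apply/funext => x /=; rewrite fg //; have [] := hpartP x HT.
exact: bounded_dist_refl.
Qed.

(** Taken at all powers of [h] at once, the bound on the distance confines
    [(a h) ^- k * (b h) ^+ k] to a ball of the word metric, which is a finite
    set. *)
Lemma fi_agree_of_bounded_dist (a b : fi_iso G) (f g : W -> W) (h : G) :
  unique_root G ->
  (forall x, fi_dom a x -> f x = a x) -> (forall x, fi_dom b x -> g x = b x) ->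
  bounded_dist f g -> fi_dom a h -> fi_dom b h -> a h = b h.
Proof.
move=> root fa gb [M [M0 MP]] ah bh.
apply: (unique_root_of_finite root (finite_word_ball genS (Num.truncn M))).
move=> k /=; have [ak <-] := fi_X k ah; have [bk <-] := fi_X k bh.
rewrite truncn_ge_nat; last exact: ltW.
by have := MP (h ^+ k); rewrite fa // gb // word_mdistE.
Qed.

Lemma LambdaM : {morph Lambda R genS : x y / x * y}.
Proof.
elim/quotW=> a; elim/quotW=> b; rewrite CommM.
pose T c := std_transversalP (@fi_domG G c).
pose T1 c := std_transversal1 (@fi_domG G c).
rewrite (LambdaE R genS (T a) (T1 a)) (LambdaE R genS (T b) (T1 b)).
rewrite (LambdaE R genS (T (fi_mul a b)) (T1 (fi_mul a b))) QIM.
apply/pi_QIE; apply: (bounded_dist_of_agree (mul_domP a b)).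
- exact: quasi_isometry_lip (qi_funP _).
- exact: quasi_isometry_lip (qi_funP _).
- move=> h dh; have [ah [_ bh]] := dh.
  apply: etrans (transversal_map_id R genS (T (fi_mul a b)) (T1 _) dh) _.
  by rewrite /= (transversal_map_id R genS (T a) (T1 a) ah) transversal_map_id.
Qed.

Lemma Lambda_inj : unique_root G -> injective (Lambda R genS).
Proof.
move=> root; elim/quotW=> a; elim/quotW=> b.
pose T c := std_transversalP (@fi_domG G c).
pose T1 c := std_transversal1 (@fi_domG G c).
rewrite (LambdaE R genS (T a) (T1 a)) (LambdaE R genS (T b) (T1 b)).
move=> /pi_QIE ab; apply/pi_commE/fi_equiv_agree => h ah bh.
have ta c x := @transversal_map_id R G S genS c _ x (T c) (T1 c).
exact: (fi_agree_of_bounded_dist root (ta a) (ta b) ab ah bh).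
Qed.

End WordSpace.

Theorem proposition5p2 (R : realType) (G : groupType) (S : seq G)
    (genS : generates S) :
  unique_root G ->
  {morph Lambda R genS : x y / x * y} /\ injective (Lambda R genS).
Proof. by move=> root; split; [exact: LambdaM|exact: Lambda_inj]. Qed.
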